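(* Let $G$ be a finite group represented (projectively) by Clifford operators $U_A(g)$ on a multiqubit system $A$ of dimension $d_A$. For every state $\rho$ on $A$, with $S:=\{g\in G\mid U_A(g)\rho U_A(g)^\dagger=\rho\}$, $N_\rho:=|G/S|$ and $\rho_g:=U_A(g)\rho U_A(g)^\dagger$, there exists a sequence of stabilizer POVMs $\{M^{(k)}_x\}_{x\in G/S}$, $k\in\mathbb{N}$, acting on $kN_\rho$ copies of $A$ such that $$\min_{g\in G}\mathrm{tr}\Big(M^{(k)}_{gS}\,\rho_g^{\otimes kN_\rho}\Big)\ge1-N_\rho\,e^{-\alpha_\rho k},$$ where $$\alpha_\rho:=\frac{d_A^2\Delta_\rho^2}{8L_\rho^2}>0 .$$
   Context: $\Delta_\rho:=\mathrm{tr}(\rho^2)-\max_{g\notin S}\mathrm{tr}(\rho\rho_g)$, defined when $S\ne G$; if $S=G$ there is only one coset, no discrimination is required, and the statement may be read with any $\alpha_\rho>0$. $L_\rho:=\sum_{P\in\mathcal{P}_A}|\mathrm{tr}(P\rho)|$, where $\mathcal{P}_A$ is the Hermitian Pauli basis on $A$ (tensor products of $I,X,Y,Z$), satisfying $\mathrm{tr}(PQ)=d_A\delta_{P,Q}$. A stabilizer POVM is a POVM whose outcome can be obtained using Clifford unitaries, stabilizer ancillas, Pauli measurements, classical randomness, classical feed-forward and classical post-processing. $G/S$ is the set of left cosets. *)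

(* Defs.v *)
From HB Require Import structures.
From mathcomp Require Import all_boot all_order all_algebra all_fingroup.
From mathcomp Require Import reals sequences exp.
From mathcomp Require Import complex mxtens spectral.

Set Implicit Arguments.
Unset Strict Implicit.
Unset Printing Implicit Defensive.

Import Order.TTheory GRing.Theory Num.Theory.
Local Open Scope ring_scope.
Local Open Scope complex_scope.
Local Open Scope sesquilinear_scope.

(* Operators on a register of [n] qubits. *)
Notation op R n := 'M[R[i]]_(2 ^ n)%N.

(* Tensor product of registers; the cast only identifies 2^m * 2^n with
   2^(m + n). *)
Definition tensq (R : realType) (m n : nat) (A : op R m) (B : op R n) :
    op R (m + n) :=
  castmx (esym (expnD 2 m n), esym (expnD 2 m n)) (tensmx A B).

(* A^{⊗ k}, on k * n qubits. *)
Fixpoint tens_pow (R : realType) (n : nat) (A : op R n) (k : nat) :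
    op R (k * n) :=
  match k with
  | 0 => 1%:M
  | k'.+1 => tensq A (tens_pow A k')
  end.

Definition conj_by (R : realType) (n : nat) (V A : op R n) : op R n :=
  V *m A *m V ^t*.

Definition psd (R : realType) (n : nat) (A : op R n) : Prop :=
  forall v : 'cV[R[i]]_(2 ^ n)%N, 0 <= (v ^t* *m A *m v) 0 0.

Definition state (R : realType) (n : nat) (rho : op R n) : Prop :=
  psd rho /\ \tr rho = 1.

Definition mx2 (R : realType) (a b c d : R[i]) : op R 1 :=
  \matrix_(i, j) nth 0 [:: a; b; c; d] (2 * i + j)%N.

(* Single-qubit Paulis indexed by (x, z): I, X, Y, Z are
   (0,0), (1,0), (1,1), (0,1). *)
Definition pauli1 (R : realType) (b : bool * bool) : op R 1 :=
  match b with
  | (false, false) => mx2 1 0 0 1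
  | (true, false) => mx2 0 1 1 0
  | (true, true) => mx2 0 (- 'i%C) 'i%C 0
  | (false, true) => mx2 1 0 0 (- 1)
  end.

Fixpoint pauli_rec (R : realType) (n : nat) : ('I_n -> bool * bool) -> op R n :=
  match n with
  | 0 => fun _ => 1%:M
  | n'.+1 => fun f =>
      tensq (pauli1 R (f ord0)) (pauli_rec R (fun i => f (lift ord0 i)))
  end.

(* The Hermitian Pauli basis on [n] qubits is the family [pauli R s], [s]
   ranging over [pauli_label n]. *)
Notation pauli_label n := {ffun 'I_n -> bool * bool}.
Definition pauli (R : realType) (n : nat) (s : pauli_label n) : op R n :=
  pauli_rec R s.

Definition pauli_group (R : realType) (n : nat) (A : op R n) : Prop :=
  exists (k : nat) (s : pauli_label n), A = 'i%C ^+ k *: pauli R s.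

Definition clifford (R : realType) (n : nat) (V : op R n) : Prop :=
  V \is unitarymx /\ forall A, pauli_group A -> pauli_group (conj_by V A).

(* |0...0><0...0| *)
Definition zero_state (R : realType) (n : nat) : op R n :=
  \matrix_(i, j) ((i == 0 :> nat) && (j == 0 :> nat))%:R.

(* Pure stabilizer states; mixtures of them come from [PRandom] below. *)
Definition stabilizer_state (R : realType) (n : nat) (sigma : op R n) : Prop :=
  exists2 V : op R n, clifford V & sigma = conj_by V (zero_state R n).

(* [true] is the outcome -1. *)
Definition pauli_proj (R : realType) (n : nat) (s : pauli_label n) (b : bool) :
    op R n :=
  2^-1 *: (1%:M + (-1) ^+ b *: pauli R s).

(* Adaptive stabilizer protocols on [n] qubits with outcomes in [X].  Feed-forward
   is the dependence of the continuation on the Pauli outcome or random index;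
   post-processing is the freedom of labelling the leaves. *)
Inductive protocol (R : realType) (X : Type) (n : nat) : Type :=
| PReturn of X
| PClifford (V : op R n) of clifford V & protocol R X n
| PAncilla (m : nat) (sigma : op R m) of
    stabilizer_state sigma & protocol R X (n + m)
| PMeasure of pauli_label n & (bool -> protocol R X n)
| PRandom (m : nat) (w : 'I_m -> R) of
    (forall i, 0 <= w i) & \sum_(i < m) w i = 1 & ('I_m -> protocol R X n).

(* Probability of the outcome [x] on input [rho]; linear in [rho], so that the
   post-measurement states need not be normalized. *)
Fixpoint outcome_prob (R : realType) (X : eqType) (n : nat)
    (T : protocol R X n) (rho : op R n) (x : X) : R[i] :=
  match T with
  | PReturn y => (y == x)%:R * \tr rho
  | PClifford V _ T' => outcome_prob T' (conj_by V rho) x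
  | PAncilla m sigma _ T' => outcome_prob T' (tensq rho sigma) x
  | PMeasure s T' =>
      \sum_(b : bool) outcome_prob (T' b) (conj_by (pauli_proj R s b) rho) x
  | PRandom m w _ _ T' => \sum_(i < m) (w i)%:C * outcome_prob (T' i) rho x
  end.

(* POVMs {M_x}_{x in D}; values of [M] outside [D] are irrelevant. *)
Definition povm (R : realType) (X : finType) (n : nat) (D : {set X})
    (M : X -> op R n) : Prop :=
  (forall x, x \in D -> psd (M x)) /\ \sum_(x in D) M x = 1%:M.

Definition stabilizer_povm (R : realType) (X : finType) (n : nat) (D : {set X})
    (M : X -> op R n) : Prop :=
  povm D M /\
  exists T : protocol R X n, forall rho, state rho ->
    forall x, x \in D -> \tr (M x *m rho) = outcome_prob T rho x.

Definition proj_repr (R : realType) (gT : finGroupType) (G : {group gT})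
    (n : nat) (U : gT -> op R n) : Prop :=
  (forall g, g \in G -> U g \is unitarymx) /\
  (forall g h, g \in G -> h \in G ->
     exists2 c : R[i], `|c| = 1 & U g *m U h = c *: U (g * h)%g).

Definition stabg (R : realType) (gT : finGroupType) (G : {group gT}) (n : nat)
    (U : gT -> op R n) (rho : op R n) : {set gT} :=
  [set g in G | conj_by (U g) rho == rho].

(* tr(A B) as a real number, for Hermitian [A] and [B]. *)
Definition rtr (R : realType) (n : nat) (A B : op R n) : R :=
  complex.Re (\tr (A *m B)).

(* The maximum is meant for S != G; overlaps of states are nonnegative, so the
   seed 0 of the iterated maximum does not affect it. *)
Definition Delta (R : realType) (gT : finGroupType) (G : {group gT}) (n : nat)
    (U : gT -> op R n) (rho : op R n) : R :=
  rtr rho rho -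
  \big[Order.max/0]_(g in G :\: stabg G U rho) rtr rho (conj_by (U g) rho).

Definition Lnorm1 (R : realType) (n : nat) (rho : op R n) : R :=
  \sum_(s : pauli_label n) ComplexField.Normc.normc (\tr (pauli R s *m rho)).

Definition alpha (R : realType) (gT : finGroupType) (G : {group gT}) (n : nat)
    (U : gT -> op R n) (rho : op R n) : R :=
  (2 ^ n)%:R ^+ 2 * Delta G U rho ^+ 2 / (8 * Lnorm1 rho ^+ 2).

(* Main.v *)
(* Each block of N copies contributes one copy per coset c.  On that copy draw a
   Pauli P with probability |tr (P rho)| / L, measure the Pauli U_c P U_c^*
   and multiply the outcome by the sign of tr (P rho).  By the Pauli Parseval
   identity the resulting sign has mean (d / L) tr (rho_c rho_g) when the input
   is rho_g, so the mean for the correct coset exceeds all the others by at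
   least d Delta / L.  Answer with a coset whose empirical mean is above the
   midpoint; by Hoeffding's inequality each of the N empirical means is on the
   wrong side with probability at most exp (- alpha k). *)
Require Import Defs.
From mathcomp Require Import all_boot all_order all_algebra all_fingroup.
From mathcomp Require Import reals sequences exp complex mxtens spectral.
From mathcomp Require Import boolp topology normedtype derive realfun.
From mathcomp Require Import lra ring.

Set Implicit Arguments.
Unset Strict Implicit.
Unset Printing Implicit Defensive.

Import Order.TTheory GRing.Theory Num.Theory numFieldNormedType.Exports.
Local Open Scope ring_scope.
Local Open Scope sesquilinear_scope.

(** * Tensor products and the Pauli basis *)

(** [Delta] is positive because the orbit states have equal purity: distinct ones have distinct
    Pauli coefficient vectors of equal norm, so the overlap of two of them is strictly below the
    purity. The midpoint lies at distance [delta = d Delta / (2 L)] from the means on either side;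
    [k] signs then cost [exp (- k delta^2 / 2)], and squaring the half gap is what turns the 2 into
    the 8 of [alpha]. The obstacle is that a protocol is a tree acting on one joint register, with
    unnormalized post-measurement operators, whereas Hoeffding's inequality wants independent signs.
    Each round measures a Pauli supported on its own copy, so on a product input the trace of the
    used copy factors out of the rest of the tree. The law of the outcomes becomes a nested finite
    sum, [seqE], whose tails are bounded by induction on the rounds. The POVM elements are not
    written down explicitly: outcome probabilities are linear in the input, and [effect] reads the
    matrices off from them. *)

Definition tens_l (m n : nat) (i : 'I_(2 ^ (m + n))) : 'I_(2 ^ m) :=
  (mxtens_unindex (cast_ord (expnD 2 m n) i)).1.

Definition tens_r (m n : nat) (i : 'I_(2 ^ (m + n))) : 'I_(2 ^ n) :=
  (mxtens_unindex (cast_ord (expnD 2 m n) i)).2.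

Definition tens_pair (m n : nat) (i : 'I_(2 ^ m)) (j : 'I_(2 ^ n)) :
    'I_(2 ^ (m + n)) :=
  cast_ord (esym (expnD 2 m n)) (mxtens_index (i, j)).

Lemma tens_pairK_l m n (i : 'I_(2 ^ m)) (j : 'I_(2 ^ n)) :
  tens_l (tens_pair i j) = i.
Proof. by rewrite /tens_l /tens_pair cast_ordKV mxtens_indexK. Qed.

Lemma tens_pairK_r m n (i : 'I_(2 ^ m)) (j : 'I_(2 ^ n)) :
  tens_r (tens_pair i j) = j.
Proof. by rewrite /tens_r /tens_pair cast_ordKV mxtens_indexK. Qed.

Lemma tens_pairE m n (i : 'I_(2 ^ (m + n))) : tens_pair (tens_l i) (tens_r i) = i.
Proof.
by rewrite /tens_l /tens_r /tens_pair -surjective_pairing mxtens_unindexK cast_ordK.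
Qed.

Lemma eq_tens m n (i j : 'I_(2 ^ (m + n))) :
  (i == j) = (tens_l i == tens_l j) && (tens_r i == tens_r j).
Proof.
apply/eqP/andP => [-> // | [/eqP el /eqP er]].
by rewrite -(tens_pairE i) el er tens_pairE.
Qed.

Lemma big_tens (R : nmodType) m n (F : 'I_(2 ^ m) -> 'I_(2 ^ n) -> R) :
  \sum_i F (tens_l i) (tens_r i) = \sum_i \sum_j F i j.
Proof.
rewrite pair_big /= (reindex (fun p => tens_pair p.1 p.2)) /=.
  by apply: eq_bigr => p _; rewrite tens_pairK_l tens_pairK_r.
exists (fun i => (tens_l i, tens_r i)) => [[i j] _ | i _] /=.
  by rewrite tens_pairK_l tens_pairK_r.
exact: tens_pairE.
Qed.

Section Tensq.
Variable R : realType.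
Implicit Types m n p : nat.

Lemma tensqE m n (A : op R m) (B : op R n) i j :
  tensq A B i j = A (tens_l i) (tens_l j) * B (tens_r i) (tens_r j).
Proof. by rewrite /tensq castmxE mxE !esymK. Qed.

Lemma tensq_mul m n (A B : op R m) (C D : op R n) :
  tensq A C *m tensq B D = tensq (A *m B) (C *m D).
Proof.
apply/matrixP => i j; rewrite tensqE !mxE big_distrlr -big_tens.
by apply: eq_bigr => k _; rewrite !tensqE mulrACA.
Qed.

Lemma mxtrace_tensq m n (A : op R m) (B : op R n) :
  \tr (tensq A B) = \tr A * \tr B.
Proof.
rewrite /mxtrace big_distrlr -big_tens.
by apply: eq_bigr => k _; rewrite tensqE.
Qed.

Lemma adj_tensq m n (A : op R m) (B : op R n) :
  (tensq A B)^t* = tensq (A^t*) (B^t*).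
Proof. by apply/matrixP => i j; rewrite tensqE !mxE tensqE rmorphM. Qed.

Lemma tensq11 m n : tensq (1%:M : op R m) (1%:M : op R n) = 1%:M.
Proof.
apply/matrixP => i j; rewrite tensqE !mxE eq_tens mulrb.
by case: eqP => _; rewrite ?mul1r ?mul0r.
Qed.

Lemma tensqDl m n (A B : op R m) (C : op R n) :
  tensq (A + B) C = tensq A C + tensq B C.
Proof. by apply/matrixP => i j; rewrite !(tensqE, mxE) mulrDl. Qed.

Lemma tensqDr m n (A : op R m) (B C : op R n) :
  tensq A (B + C) = tensq A B + tensq A C.
Proof. by apply/matrixP => i j; rewrite !(tensqE, mxE) mulrDr. Qed.

Lemma tensqZl m n (c : R[i]) (A : op R m) (C : op R n) :
  tensq (c *: A) C = c *: tensq A C.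
Proof. by apply/matrixP => i j; rewrite !(tensqE, mxE) mulrA. Qed.

Lemma tensqZr m n (c : R[i]) (A : op R m) (C : op R n) :
  tensq A (c *: C) = c *: tensq A C.
Proof. by apply/matrixP => i j; rewrite !(tensqE, mxE) mulrCA. Qed.

(** With a single leading qubit, [1 + m + n] and [1 + (m + n)] are convertible, so associativity can
    be stated without a cast. This is the case that the recursion of [pauli_rec] calls for. *)
Lemma tensqA1 m n (A : op R 1) (B : op R m) (C : op R n) :
  tensq (tensq A B) C = tensq A (tensq B C) :> op R (1 + m + n).
Proof.
apply/matrixP => i j.
rewrite (tensqE (tensq A B) C) (tensqE A B).
rewrite (@tensqE 1 (m + n) A (tensq B C)) (tensqE B C) mulrA.
have e1 (k : 'I_(2 ^ (1 + m + n))) :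
    tens_l (tens_l k) = @tens_l 1 (m + n) k.
  by apply: val_inj; rewrite /= -divnMA mulnC -expnD.
have e2 (k : 'I_(2 ^ (1 + m + n))) :
    tens_r (tens_l k) = tens_l (@tens_r 1 (m + n) k).
  by apply: val_inj; rewrite /= modn_divl -expnD.
have e3 (k : 'I_(2 ^ (1 + m + n))) :
    tens_r k = tens_r (@tens_r 1 (m + n) k).
  by apply: val_inj; rewrite /= modn_dvdm // expnD dvdn_mull.
by rewrite !e1 !e2 !e3.
Qed.

Lemma tens1q n (A : op R n) : tensq (1%:M : op R 0) A = A.
Proof.
apply/matrixP => i j; rewrite (@tensqE 0 n) !ord1 mxE eqxx mul1r.
by congr (A _ _); apply: val_inj; rewrite /= modn_small.
Qed.

Lemma pauli_rec_ext n (f g : 'I_n -> bool * bool) :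
  f =1 g -> pauli_rec R f = pauli_rec R g.
Proof.
elim: n f g => //= n IH f g fg; rewrite fg.
by rewrite (IH _ (fun i => g (lift ord0 i))) // => i; apply: fg.
Qed.

Lemma pauli_rec_cat m n (f : 'I_(m + n) -> bool * bool) :
  pauli_rec R f =
  tensq (pauli_rec R (f \o @lshift m n)) (pauli_rec R (f \o @rshift m n)).
Proof.
elim: m f => [|m IH] f.
  rewrite tens1q; apply: pauli_rec_ext => i /=.
  by congr f; apply: val_inj.
rewrite [LHS]/= [pauli_rec R (f \o _)]/= tensqA1 IH.
have -> : pauli_rec R ((fun i => f (lift ord0 i)) \o @lshift m n) =
    pauli_rec R (fun i => (f \o @lshift m.+1 n) (lift ord0 i)).
  by apply: pauli_rec_ext => i /=; congr f; apply: val_inj.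
have -> : pauli_rec R ((fun i => f (lift ord0 i)) \o @rshift m n) =
    pauli_rec R (f \o @rshift m.+1 n).
  by apply: pauli_rec_ext => i /=; congr f; apply: val_inj.
by have -> : @ord0 (m + n) = lshift n (@ord0 m) by apply: val_inj.
Qed.

Lemma pauli1_adj b : (pauli1 R b)^t* = pauli1 R b.
Proof.
apply/matrixP => i j; rewrite !mxE.
case: i => [[|[|//]] Hi]; case: j => [[|[|//]] Hj]; case: b => [[] []];
  rewrite !mxE /=; apply/eqP; rewrite eq_complex /= ?oppr0 ?opprK !eqxx //.
Qed.

Lemma pauli1_sqr b : pauli1 R b *m pauli1 R b = 1%:M.
Proof.
apply/matrixP => i j; rewrite !mxE !big_ord_recl big_ord0 /=.
case: i => [[|[|//]] Hi]; case: j => [[|[|//]] Hj]; case: b => [[] []];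
  rewrite !mxE /=; apply/eqP; rewrite eq_complex /=
    ?(mulr0, mul0r, mulr1, mul1r, addr0, add0r, mulrNN, mulrN, mulNr, opprK, oppr0,
      subrr, subr0) ?eqxx //.
Qed.

Lemma pauli1_complete (i j k l : 'I_(2 ^ 1)) :
  \sum_b pauli1 R b i j * pauli1 R b k l = ((i == l) && (j == k))%:R *+ 2.
Proof.
transitivity (\sum_x \sum_z pauli1 R (x, z) i j * pauli1 R (x, z) k l).
  by rewrite pair_bigA; apply: eq_bigr => -[].
rewrite !big_bool /=.
case: i => [[|[|//]] Hi]; case: j => [[|[|//]] Hj]; case: k => [[|[|//]] Hk];
case: l => [[|[|//]] Hl];
  rewrite !mxE /= ?mulr2n; apply/eqP; rewrite eq_complex /=
    ?(mulr0, mul0r, mulr1, mul1r, addr0, add0r, mulrNN, mulrN, mulNr, opprK, oppr0,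
      subrr, subr0, addrN, addNr) ?eqxx //.
Qed.

Lemma pauli_rec_adj n (f : 'I_n -> bool * bool) :
  (pauli_rec R f)^t* = pauli_rec R f.
Proof.
elim: n f => [|n IH] f /=; first by rewrite trmx1 map_mx1.
by rewrite (@adj_tensq 1 n) pauli1_adj IH.
Qed.

Lemma pauli_rec_sqr n (f : 'I_n -> bool * bool) :
  pauli_rec R f *m pauli_rec R f = 1%:M.
Proof.
elim: n f => [|n IH] f /=; first by rewrite mulmx1.
by rewrite (@tensq_mul 1 n) pauli1_sqr IH (@tensq11 1 n).
Qed.

Lemma big_ffun_recl n (T : finType) (V : nmodType) (F : {ffun 'I_n.+1 -> T} -> V) :
  \sum_s F s = \sum_b \sum_(t : {ffun 'I_n -> T})
     F [ffun i => oapp t b (unlift ord0 i)].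
Proof.
rewrite pair_big /= (reindex (fun p : T * {ffun 'I_n -> T} =>
  [ffun i => oapp p.2 p.1 (unlift ord0 i)])) //=.
exists (fun s : {ffun 'I_n.+1 -> T} => (s ord0, [ffun i => s (lift ord0 i)]))
  => [[b t] _ | s _] /=.
  rewrite ffunE unlift_none; congr pair.
  by apply/ffunP => i; rewrite !ffunE liftK.
apply/ffunP => i; rewrite ffunE.
by case: unliftP => [j|] -> //=; rewrite ffunE.
Qed.

(** Entrywise form of the identity that the sum of all [P ⊗ P] is [d] times the swap operator. It is
    multiplicative over qubits, which leaves the 16 entries of one qubit to check. *)
Lemma pauli_complete n (i j k l : 'I_(2 ^ n)) :
  \sum_(s : pauli_label n) pauli R s i j * pauli R s k l =
  ((i == l) && (j == k))%:R * 2 ^+ n.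
Proof.
rewrite /pauli; elim: n i j k l => [|n IH] i j k l.
  rewrite !ord1 !eqxx (big_pred1 [ffun=> (false, false)]) /=.
    by rewrite !mxE !mulr1.
  by move=> s; apply/esym/eqP/ffunP => -[].
rewrite big_ffun_recl.
transitivity (\sum_b \sum_(t : pauli_label n)
   (pauli1 R b (@tens_l 1 n i) (@tens_l 1 n j) *
    pauli1 R b (@tens_l 1 n k) (@tens_l 1 n l)) *
   (pauli_rec R t (@tens_r 1 n i) (@tens_r 1 n j) *
    pauli_rec R t (@tens_r 1 n k) (@tens_r 1 n l))).
  apply: eq_bigr => b _; apply: eq_bigr => t _ /=.
  rewrite (@tensqE 1 n) (@tensqE 1 n) mulrACA ffunE unlift_none /=.
  congr (_ * _); rewrite (pauli_rec_ext (g := t)) // => a.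
  by rewrite ffunE liftK.
rewrite -big_distrlr /= IH pauli1_complete (@eq_tens 1 n i) (@eq_tens 1 n j).
rewrite andbACA -mulr_natr exprS mulrA.
by do 2 case: (_ && _); rewrite /= ?(mul1r, mul0r, mulr0, mulr1).
Qed.

Lemma parseval n (A B : op R n) :
  \sum_(s : pauli_label n) \tr (pauli R s *m A) * \tr (pauli R s *m B) =
  2 ^+ n * \tr (A *m B).
Proof.
have trE (s : pauli_label n) (C : op R n) :
    \tr (pauli R s *m C) = \sum_i \sum_j pauli R s i j * C j i.
  by apply: eq_bigr => i _; rewrite mxE.
transitivity (\sum_i \sum_j \sum_k \sum_l
   (\sum_(s : pauli_label n) pauli R s i j * pauli R s k l) * (A j i * B l k)).
  under eq_bigr => s _.
    rewrite !trE big_distrl /=.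
    under eq_bigr => i _.
      rewrite big_distrlr /=.
      under eq_bigr => j _ do under eq_bigr => k _ do rewrite big_distrr /=.
      over.
    over.
  rewrite exchange_big; apply: eq_bigr => i _.
  rewrite exchange_big; apply: eq_bigr => j _.
  rewrite exchange_big; apply: eq_bigr => k _.
  rewrite exchange_big; apply: eq_bigr => l _.
  by rewrite big_distrl; apply: eq_bigr => s _; rewrite mulrACA.
rewrite /mxtrace exchange_big big_distrr; apply: eq_bigr => j _ /=.
rewrite mxE big_distrr; apply: eq_bigr => i _ /=.
(* Completeness keeps only [k = j] and [l = i], that is the term [A j i * B i j] of the trace. *)
rewrite (bigD1 j) //= [X in _ + X]big1 ?addr0 => [|k /negPf kj]; last first.
  by apply: big1 => l _; rewrite pauli_complete (eq_sym j) kj andbF !mul0r.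
rewrite (bigD1 i) //= [X in _ + X]big1 ?addr0 => [|l /negPf li].
  by rewrite pauli_complete !eqxx mul1r.
by rewrite pauli_complete eq_sym li !mul0r.
Qed.

End Tensq.

(** * Hoeffding bound for threshold decoding *)

Section TailBound.
Variable R : realType.
Implicit Types x y : R.

Lemma ge0_derive_ge0 (f df : R -> R) x :
  (forall y, is_derive y 1 f (df y)) -> (forall y, 0 <= y -> 0 <= df y) ->
  0 <= x -> f 0 <= f x.
Proof.
move=> fD df_ge0 x_ge0.
have [|y /[!in_itv]/= /andP[y_ge0 _] fE] :=
    @MVT_segment R f df 0 x x_ge0 (fun y _ => fD y).
  by apply: derivable_within_continuous => y _; have [] := fD y.
by rewrite -subr_ge0 fE subr0 mulr_ge0 // df_ge0.
Qed.

(* [psi / phi] is the derivative of [ln phi]; its own derivative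
   [1 - (psi / phi) ^+ 2] is at most 1, so [psi / phi] stays below [p - q + x] and
   [ln phi] below [(p - q) * x + x ^+ 2 / 2]. *)
Lemma hoeffding_two_point_ge0 (p q : R) x :
  0 <= p -> 0 <= q -> p + q = 1 -> 0 <= x ->
  p * expR x + q * expR (- x) <= expR ((p - q) * x + x ^+ 2 / 2).
Proof.
move=> p_ge0 q_ge0 pq1 x_ge0.
pose phi y := p * expR y + q * expR (- y).
pose psi y := p * expR y - q * expR (- y).
have phi_gt0 y : 0 < phi y.
  rewrite /phi; have ey := expR_gt0 y; have eNy := expR_gt0 (- y).
  have [p_le0|p_gt0] := leP p 0; last first.
    by rewrite ltr_wpDr ?mulr_ge0 ?mulr_gt0 // ltW.
  by rewrite ltr_wpDl ?mulr_ge0 ?mulr_gt0 // ?ltW //; lra.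
have phiD (y : R) : is_derive y 1 phi (psi y).
  rewrite /phi; apply: is_derive_eq.
  rewrite /psi /GRing.scale /=; ring.
have psiD (y : R) : is_derive y 1 psi (phi y).
  rewrite /psi; apply: is_derive_eq.
  rewrite /phi /GRing.scale /=; ring.
have psi_le y : 0 <= y -> psi y <= (y + (p - q)) * phi y.
  move=> y_ge0; pose v z := z - psi z / phi z.
  have vD (z : R) : is_derive z 1 v ((psi z / phi z) ^+ 2).
    have phi_neq0 : phi z != 0 by rewrite gt_eqF.
    have := is_deriveB (is_derive_id z (1 : R))
      (is_deriveM (psiD z) (is_deriveV phi_neq0 (phiD z))).
    move=> D; apply: (is_derive_eq D).
    rewrite /GRing.scale /=; field.
    exact: phi_neq0.
  have := ge0_derive_ge0 vD (fun z _ => sqr_ge0 _) y_ge0.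
  have -> : v 0 = - (p - q).
    by rewrite /v /psi /phi oppr0 expR0 !mulr1 pq1 divr1 add0r.
  by rewrite /v -ler_pdivrMr //; lra.
(* Minus the ratio of the two sides, which avoids logarithms: [w] starts at [- 1], and [psi_le]
   makes its derivative nonnegative on the half-line. *)
pose w y := - (phi y * expR (- ((p - q) * y + y ^+ 2 / 2))).
have wD (y : R) : is_derive y 1 w
    (((y + (p - q)) * phi y - psi y) * expR (- ((p - q) * y + y ^+ 2 / 2))).
  rewrite /w; apply: is_derive_eq.
  by rewrite /GRing.scale /=; field; rewrite ?pnatr_eq0.
have w0 : w 0 = - 1.
  by rewrite /w /phi !(mulr0, expr0n, mul0r, addr0, oppr0) /= expR0 !mulr1 pq1.
have : w 0 <= w x.
  apply: (ge0_derive_ge0 wD) x_ge0 => y y_ge0.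
  by rewrite mulr_ge0 ?expR_ge0 // subr_ge0 psi_le.
by rewrite w0 lerN2 expRN ler_pdivrMr ?expR_gt0 // mul1r.
Qed.

Lemma hoeffding_two_point (p q : R) x :
  0 <= p -> 0 <= q -> p + q = 1 ->
  p * expR x + q * expR (- x) <= expR ((p - q) * x + x ^+ 2 / 2).
Proof.
move=> p_ge0 q_ge0 pq1; have [x_ge0|x_le0] := leP 0 x.
  exact: hoeffding_two_point_ge0.
have qp1 : q + p = 1 by rewrite addrC.
have Nx_ge0 : 0 <= - x by lra.
have := hoeffding_two_point_ge0 q_ge0 p_ge0 qp1 Nx_ge0.
by rewrite opprK sqrrN mulrN -mulNr opprB [leLHS]addrC.
Qed.

Section Expectation.
Variables (C : eqType) (q : C -> bool -> R).

(** Expectation over [m] independent bits, the [i]-th one with law [q (t i)], where [t] is the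
    schedule of tested hypotheses. Nesting the sums, rather than summing over bit tuples, matches
    the recursion of [outcome_prob] round by round. *)
Fixpoint seqE (m : nat) (t : nat -> C) (h : seq bool -> R) : R :=
  match m with
  | 0 => h [::]
  | m'.+1 => \sum_b q (t 0%N) b * seqE m' (t \o succn) (h \o cons b)
  end.

Fixpoint sgn_sum (t : nat -> C) (c : C) (bs : seq bool) : R :=
  match bs with
  | [::] => 0
  | b :: bs' => (t 0%N == c)%:R * (-1) ^+ b + sgn_sum (t \o succn) c bs'
  end.

Lemma seqE_sum (I : Type) (r : seq I) (P : pred I) m t (h : I -> seq bool -> R) :
  seqE m t (fun bs => \sum_(i <- r | P i) h i bs) =
  \sum_(i <- r | P i) seqE m t (h i).
Proof.
elim: m t h => //= m IH t h; rewrite exchange_big; apply: eq_bigr => b _.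
by rewrite -big_distrr -IH.
Qed.

Lemma seqEZ m t (l : R) h : seqE m t (fun bs => l * h bs) = l * seqE m t h.
Proof.
elim: m t h => //= m IH t h; rewrite big_distrr; apply: eq_bigr => b _ /=.
by rewrite [RHS]mulrCA -IH.
Qed.

Lemma seqED m t h1 h2 :
  seqE m t (fun bs => h1 bs + h2 bs) = seqE m t h1 + seqE m t h2.
Proof.
elim: m t h1 h2 => //= m IH t h1 h2; rewrite -big_split; apply: eq_bigr => b _ /=.
by rewrite -mulrDr -IH.
Qed.

Lemma eq_seqE m t h1 h2 : h1 =1 h2 -> seqE m t h1 = seqE m t h2.
Proof.
elim: m t h1 h2 => [|m IH] t h1 h2 h12 /=; first exact: h12.
by apply: eq_bigr => b _; congr (_ * _); apply: IH => bs; apply: h12.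
Qed.

Hypothesis q_ge0 : forall c b, 0 <= q c b.
Hypothesis q_sum : forall c, q c false + q c true = 1.

Lemma le_seqE m t h1 h2 : (forall bs, h1 bs <= h2 bs) ->
  seqE m t h1 <= seqE m t h2.
Proof.
elim: m t h1 h2 => [|m IH] t h1 h2 h12 /=; first exact: h12.
by apply: ler_sum => b _; rewrite ler_wpM2l //; apply: IH => bs; apply: h12.
Qed.

Lemma seqE1 m t : seqE m t (fun=> 1) = 1.
Proof.
elim: m t => //= m IH t; rewrite big_bool /=.
by rewrite !(eq_seqE _ _ (h2 := fun=> 1)) // !IH !mulr1 addrC q_sum.
Qed.

Definition bias (c : C) : R := q c false - q c true.

(** Rounds spent on another hypothesis contribute a factor 1, the others one two-point bound each;
    hence the schedule enters only through the number of rounds spent on [c]. *)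
Lemma seqE_expR m t c l :
  seqE m t (fun bs => expR (l * sgn_sum t c bs)) <=
  expR ((l * bias c + l ^+ 2 / 2) * \sum_(i < m) (t i == c)%:R).
Proof.
elim: m t => [|m IH] t /=; first by rewrite big_ord0 !mulr0.
rewrite big_ord_recl mulrDr expRD.
under eq_bigr => b _.
  rewrite (eq_seqE _ _ (h2 := fun bs => expR (l * ((t 0%N == c)%:R * (-1) ^+ b)) *
     expR (l * sgn_sum (t \o succn) c bs))); last first.
    by move=> bs /=; rewrite mulrDr expRD.
  rewrite seqEZ mulrA.
  over.
rewrite -big_distrl /= big_bool /=.
have tail_ge0 : 0 <= seqE m (t \o succn)
    (fun bs => expR (l * sgn_sum (t \o succn) c bs)).
  rewrite -[leLHS](mul0r (seqE m (t \o succn) (fun=> 1))) -seqEZ.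
  by apply: le_seqE => bs; rewrite mul0r expR_ge0.
apply: ler_pM => //.
  by rewrite addr_ge0 // mulr_ge0 ?expR_ge0.
case: eqP => [->|_]; last by rewrite !mul0r !mulr0 expR0 !mulr1 addrC q_sum.
rewrite !mul1r expr0 expr1 !mulr1 mulrN1 addrC [l * _]mulrC.
exact: hoeffding_two_point.
Qed.

Variables (k : nat) (m : nat) (t : nat -> C) (theta delta : R).

Lemma upper_tail c :
  \sum_(i < m) (t i == c)%:R = k%:R :> R -> bias c <= theta - delta ->
  0 <= delta ->
  seqE m t (fun bs => (k%:R * theta < sgn_sum t c bs)%R%:R) <=
  expR (- (delta ^+ 2 / 2 * k%:R)).
Proof.
move=> cnt bias_le delta_ge0.
(* Chernoff bound with parameter [delta], the minimizer of [l ^+ 2 / 2 - l * delta]; [lower_tail]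
   uses [- delta]. *)
apply: (@le_trans _ _ (seqE m t (fun bs => expR (- (delta * (k%:R * theta))) *
   expR (delta * sgn_sum t c bs)))).
  apply: le_seqE => bs; case: ltP => [lt|_]; last by rewrite mulr_ge0 ?expR_ge0.
  rewrite -expRD /= -[leLHS]expR0 ler_expR addrC -mulrBr mulr_ge0 //.
  by rewrite subr_ge0 ltW.
rewrite seqEZ; apply: le_trans (ler_wpM2l (expR_ge0 _) (seqE_expR _ _ _ _)) _.
rewrite cnt -expRD ler_expR.
have k_ge0 : 0 <= k%:R :> R by [].
have : delta * bias c * k%:R <= delta * (theta - delta) * k%:R.
  by rewrite ler_wpM2r // ler_wpM2l.
lra.
Qed.

Lemma lower_tail c :
  \sum_(i < m) (t i == c)%:R = k%:R :> R -> theta + delta <= bias c ->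
  0 <= delta ->
  seqE m t (fun bs => (sgn_sum t c bs <= k%:R * theta)%R%:R) <=
  expR (- (delta ^+ 2 / 2 * k%:R)).
Proof.
move=> cnt bias_ge delta_ge0.
apply: (@le_trans _ _ (seqE m t (fun bs => expR (delta * (k%:R * theta)) *
   expR (- delta * sgn_sum t c bs)))).
  apply: le_seqE => bs; case: (leP (sgn_sum t c bs)) => [le|_];
    last by rewrite mulr_ge0 ?expR_ge0.
  rewrite -expRD /= -[leLHS]expR0 ler_expR mulNr -mulrBr mulr_ge0 //.
  by rewrite subr_ge0.
rewrite seqEZ; apply: le_trans (ler_wpM2l (expR_ge0 _) (seqE_expR _ _ _ _)) _.
rewrite cnt -expRD ler_expR.
have k_ge0 : 0 <= k%:R :> R by [].
have : delta * (theta + delta) * k%:R <= delta * bias c * k%:R.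
  by rewrite ler_wpM2r // ler_wpM2l.
lra.
Qed.

End Expectation.

Definition threshold_decode (C : finType) (D : {set C}) (c1 : C) (t : nat -> C)
    (T : R) (bs : seq bool) : C :=
  odflt c1 [pick c in D | T < sgn_sum t c bs].

Lemma threshold_decode_in (C : finType) (D : {set C}) (c1 : C) t T bs :
  c1 \in D -> threshold_decode D c1 t T bs \in D.
Proof.
by rewrite /threshold_decode; case: pickP => [c /andP[]|].
Qed.

Lemma threshold_decodeP (C : finType) (q : C -> bool -> R) (D : {set C}) c1 c0
    (k m : nat) (t : nat -> C) (theta delta : R) :
  (forall c b, 0 <= q c b) -> (forall c, q c false + q c true = 1) ->
  0 <= delta -> c0 \in D ->
  (forall c, c \in D -> \sum_(i < m) (t i == c)%:R = k%:R :> R) ->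
  theta + delta <= bias q c0 ->
  (forall c, c \in D -> c != c0 -> bias q c <= theta - delta) ->
  1 - #|D|%:R * expR (- (delta ^+ 2 / 2 * k%:R)) <=
  seqE q m t (fun bs => (threshold_decode D c1 t (k%:R * theta) bs == c0)%:R).
Proof.
move=> q_ge0 q_sum delta_ge0 c0D cnt bias0 bias1.
(* Union bound: the indicator of a correct answer is at least 1 minus the number of hypotheses on
   the wrong side of the threshold. *)
pose bad c bs : bool := if c == c0 then sgn_sum t c bs <= k%:R * theta
   else k%:R * theta < sgn_sum t c bs.
apply: (@le_trans _ _ (seqE q m t (fun bs => 1 + -1 * \sum_(c in D) (bad c bs)%:R))).
  rewrite seqED seqE1 // seqEZ seqE_sum mulN1r lerD2l lerN2.
  rewrite mulr_natl -sumr_const; apply: ler_sum => c cD; rewrite /bad.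
  case: eqP => [->|/eqP cc0]; first exact: lower_tail (cnt _ c0D) bias0 _.
  exact: upper_tail (cnt _ cD) (bias1 _ cD cc0) _.
apply: le_seqE => // bs; rewrite mulN1r.
have bad_ge0 c : 0 <= (bad c bs)%:R :> R by [].
have le1 c : c \in D -> bad c bs ->
    1 - \sum_(c in D) (bad c bs)%:R <= 0 :> R.
  move=> cD cbad; rewrite subr_le0 (bigD1 c) //= cbad lerDl.
  by apply: sumr_ge0.
case: eqP => [_|/eqP ne].
  by rewrite gerBl; apply: sumr_ge0.
(* If [c0] passes the threshold, something is picked, so a wrong answer is itself a bad hypothesis
   and the default is not reached. *)
have [bad0|] := boolP (bad c0 bs); first exact: le1 bad0.
rewrite /bad eqxx -ltNge => good0.
move: ne; rewrite /threshold_decode; case: pickP => [c /andP[cD gc] /= cc0|].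
  by apply: (le1 c cD); rewrite /bad (negPf cc0).
by move=> /(_ c0); rewrite c0D good0.
Qed.

End TailBound.

(** * POVM elements of adaptive protocols *)

Section Protocols.
Variable R : realType.

Lemma conj_byD n (V A B : op R n) : conj_by V (A + B) = conj_by V A + conj_by V B.
Proof. by rewrite /conj_by mulmxDr mulmxDl. Qed.

Lemma conj_byZ n (V A : op R n) c : conj_by V (c *: A) = c *: conj_by V A.
Proof. by rewrite /conj_by -scalemxAr -scalemxAl. Qed.

Lemma conj_by_comp n (V W A : op R n) :
  conj_by V (conj_by W A) = conj_by (V *m W) A.
Proof. by rewrite /conj_by trmx_mul map_mxM !mulmxA. Qed.

Lemma unitarymx_adjl n (V : op R n) : V \is unitarymx -> V^t* *m V = 1%:M.
Proof. by move=> Vu; have := mulmxKtV 1%:M Vu (erefl _); rewrite !mul1mx. Qed.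

Lemma conj_by_mul n (V A B : op R n) : V \is unitarymx ->
  conj_by V A *m conj_by V B = conj_by V (A *m B).
Proof.
move=> Vu; rewrite /conj_by -!mulmxA; do 2 congr (_ *m _).
by rewrite [V^t* *m _]mulmxA unitarymx_adjl // mul1mx.
Qed.

Lemma mxtrace_conj_by n (V A : op R n) : V \is unitarymx ->
  \tr (conj_by V A) = \tr A.
Proof. by move=> Vu; rewrite /conj_by mxtrace_mulC mulmxA unitarymx_adjl ?mul1mx. Qed.

Lemma conj_by_tensq m n (V A : op R m) (W B : op R n) :
  conj_by (tensq V W) (tensq A B) = tensq (conj_by V A) (conj_by W B).
Proof. by rewrite /conj_by adj_tensq !tensq_mul. Qed.

Lemma conj_by_rank1 n (V : op R n) (v : 'cV[R[i]]_(2 ^ n)) :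
  conj_by V (v *m v^t*) = (V *m v) *m (V *m v)^t*.
Proof. by rewrite /conj_by trmx_mul map_mxM !mulmxA. Qed.

Lemma zero_state_rank1 n :
  exists v : 'cV[R[i]]_(2 ^ n), zero_state R n = v *m v^t*.
Proof.
exists (\col_i (i == 0 :> nat)%:R); apply/matrixP => i j.
by rewrite !mxE big_ord1 !mxE rmorph_nat -natrM mulnb.
Qed.

Lemma stabilizer_state_rank1 n (sigma : op R n) : stabilizer_state sigma ->
  exists v : 'cV[R[i]]_(2 ^ n), sigma = v *m v^t*.
Proof.
case=> V _ ->; have [v ->] := zero_state_rank1 n.
by exists (V *m v); rewrite conj_by_rank1.
Qed.

Lemma tensq_rank1 m n (v : 'cV[R[i]]_(2 ^ m)) (w : 'cV[R[i]]_(2 ^ n)) :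
  exists u : 'cV[R[i]]_(2 ^ (m + n)),
    tensq (v *m v^t*) (w *m w^t*) = u *m u^t*.
Proof.
exists (\col_i (v (tens_l i) 0 * w (tens_r i) 0)); apply/matrixP => i j.
by rewrite tensqE !mxE !big_ord1 !mxE rmorphM mulrACA.
Qed.

Lemma mxtrace_stabilizer_state n (sigma : op R n) : stabilizer_state sigma ->
  \tr sigma = 1.
Proof.
case=> V [Vu _] ->; rewrite mxtrace_conj_by //.
have n_gt0 : (0 < 2 ^ n)%N by rewrite expn_gt0.
rewrite /mxtrace (bigD1 (Ordinal n_gt0)) //= big1 ?addr0 => [|i i0].
  by rewrite mxE.
rewrite mxE andbb; case: eqP => // i0'.
by case/eqP: i0; apply: val_inj.
Qed.

Lemma pauli_proj_adj n (s : pauli_label n) b :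
  (pauli_proj R s b)^t* = pauli_proj R s b.
Proof.
rewrite /pauli_proj !(linearZ, linearD) /= !(map_mxZ, map_mxD) trmx1 map_mx1.
rewrite [(pauli R s)^t*]pauli_rec_adj.
by rewrite fmorphV rmorph_nat rmorphXn rmorphN1 scalerDr !scalerA mulrC.
Qed.

Lemma pauli_sqr n (s : pauli_label n) : pauli R s *m pauli R s = 1%:M.
Proof. exact: pauli_rec_sqr. Qed.

Lemma pauli_proj_idem n (s : pauli_label n) b :
  pauli_proj R s b *m pauli_proj R s b = pauli_proj R s b.
Proof.
rewrite /pauli_proj -scalemxAl -scalemxAr; set A := 1%:M + _.
have -> : A *m A = 2 *: A.
  rewrite {1}/A mulmxDl mul1mx -scalemxAl {2}/A mulmxDr mulmx1 -scalemxAr pauli_sqr.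
  by rewrite scalerDr scalerA -expr2 sqrr_sign scale1r [_ + 1%:M]addrC
    scaler_nat mulr2n.
by rewrite !scalerA -mulrA mulVf ?mulr1 // pnatr_eq0.
Qed.

Lemma mxtrace_measure n (s : pauli_label n) b (rho : op R n) :
  \tr (conj_by (pauli_proj R s b) rho) =
  2^-1 * (\tr rho + (-1) ^+ b * \tr (pauli R s *m rho)).
Proof.
rewrite /conj_by pauli_proj_adj mxtrace_mulC mulmxA pauli_proj_idem /pauli_proj.
by rewrite -scalemxAl mxtraceZ mulmxDl mul1mx mxtraceD -scalemxAl mxtraceZ.
Qed.

Section Effects.
Variable X : eqType.

Lemma outcome_probD n (T : protocol R X n) A B x :
  outcome_prob T (A + B) x = outcome_prob T A x + outcome_prob T B x.
Proof.
elim: T A B => {n} /= [n y|n V _ T IH|n m s _ T IH|n s T IH|n m w _ _ T IH] A B.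
- by rewrite mxtraceD mulrDr.
- by rewrite conj_byD IH.
- by rewrite tensqDl IH.
- by rewrite -big_split; apply: eq_bigr => b _; rewrite conj_byD IH.
- by rewrite -big_split; apply: eq_bigr => i _; rewrite IH mulrDr.
Qed.

Lemma outcome_probZ n (T : protocol R X n) c A x :
  outcome_prob T (c *: A) x = c * outcome_prob T A x.
Proof.
elim: T A => {n} /= [n y|n V _ T IH|n m s _ T IH|n s T IH|n m w _ _ T IH] A.
- by rewrite mxtraceZ mulrCA.
- by rewrite conj_byZ IH.
- by rewrite tensqZl IH.
- by rewrite big_distrr; apply: eq_bigr => b _; rewrite conj_byZ IH.
- by rewrite big_distrr; apply: eq_bigr => i _; rewrite IH mulrCA.
Qed.

(* Pure inputs stay pure along every branch, which is why positivity can be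
   checked on rank-one operators. *)
Lemma outcome_prob_rank1_ge0 n (T : protocol R X n) (v : 'cV[R[i]]_(2 ^ n)) x :
  0 <= outcome_prob T (v *m v^t*) x.
Proof.
elim: T v => {n} /= [n y|n V _ T IH|n m s sP T IH|n s T IH|n m w w0 _ T IH] v.
- rewrite mulr_ge0 //; apply: sumr_ge0 => i _.
  by rewrite mxE big_ord1 !mxE mul_conjC_ge0.
- by rewrite conj_by_rank1.
- have [w ->] := stabilizer_state_rank1 sP.
  by have [u ->] := tensq_rank1 v w.
- by apply: sumr_ge0 => b _; rewrite conj_by_rank1.
- by apply: sumr_ge0 => i _; rewrite mulr_ge0 // ler0c.
Qed.

(** The matrix representing the linear functional [outcome_prob T _ x] under the trace pairing; this
    pairing is why the indices of [delta_mx] are swapped. *)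
Definition effect n (T : protocol R X n) (x : X) : op R n :=
  \matrix_(i, j) outcome_prob T (delta_mx j i) x.

Lemma mxtrace_effect n (T : protocol R X n) x rho :
  \tr (effect T x *m rho) = outcome_prob T rho x.
Proof.
have prob0 : outcome_prob T 0 x = 0.
  by rewrite -(scale0r (0 : op R n)) outcome_probZ mul0r.
have probS (F : 'I_(2 ^ n) -> op R n) :
    outcome_prob T (\sum_i F i) x = \sum_i outcome_prob T (F i) x.
  exact: (big_morph (fun A => outcome_prob T A x)
            (fun A B => outcome_probD T A B x) prob0).
rewrite [in RHS](matrix_sum_delta rho) probS.
under [RHS]eq_bigr => i _ do rewrite probS.
rewrite exchange_big; apply: eq_bigr => i _; rewrite mxE.
by apply: eq_bigr => j _; rewrite outcome_probZ mxE mulrC.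
Qed.

Lemma psd_effect n (T : protocol R X n) x : psd (effect T x).
Proof.
move=> v; have := outcome_prob_rank1_ge0 T v x.
by rewrite -mxtrace_effect mulmxA mxtrace_mulC mulmxA /mxtrace big_ord1.
Qed.

End Effects.

Fixpoint leaves_in (X : finType) (D : {set X}) n (T : protocol R X n) : Prop :=
  match T with
  | PReturn y => y \in D
  | PClifford _ _ T' => leaves_in D T'
  | PAncilla _ _ _ T' => leaves_in D T'
  | PMeasure _ T' => forall b, leaves_in D (T' b)
  | PRandom _ _ _ _ T' => forall i, leaves_in D (T' i)
  end.

Lemma outcome_prob_sum (X : finType) (D : {set X}) n (T : protocol R X n) rho :
  leaves_in D T -> \sum_(x in D) outcome_prob T rho x = \tr rho.
Proof.
elim: T rho => {n} /= [n y|n V Vc T IH|n m s sP T IH|n s T IH|n m w _ w1 T IH] rho.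
- move=> yD; rewrite (bigD1 y) //= eqxx mul1r big1 ?addr0 // => x /andP[_ xy].
  by rewrite eq_sym (negPf xy) mul0r.
- by move=> TD; rewrite IH // mxtrace_conj_by //; case: Vc.
- by move=> TD; rewrite IH // mxtrace_tensq (mxtrace_stabilizer_state sP) mulr1.
- move=> TD; rewrite exchange_big.
  transitivity (\sum_(b : bool) 2^-1 * (\tr rho + (-1) ^+ b * \tr (pauli R s *m rho))).
    by apply: eq_bigr => b _; apply: etrans (IH b _ (TD b)) (mxtrace_measure s b rho).
  rewrite -big_distrr big_split sumr_const card_bool big_bool /= expr0 expr1.
  by rewrite mulN1r mul1r addNr addr0 -[\tr rho *+ 2]mulr_natl mulrA
    mulVf ?mul1r ?pnatr_eq0.
- move=> TD; rewrite exchange_big /=.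
  transitivity (\sum_i (w i)%:C%C * \tr rho).
    by apply: eq_bigr => i _; rewrite -big_distrr; congr (_ * _); apply: IH.
  have w1C : \sum_i (w i)%:C%C = 1 :> R[i] by rewrite -rmorph_sum w1 rmorph1.
  by rewrite -big_distrl /= w1C mul1r.
Qed.

Lemma stabilizer_povm_effect (X : finType) (D : {set X}) n (T : protocol R X n) :
  leaves_in D T -> stabilizer_povm D (effect T).
Proof.
move=> TD; split; last by exists T => rho _ x _; apply: mxtrace_effect.
split=> [x _|]; first exact: psd_effect.
apply/matrixP => i j; rewrite summxE.
under eq_bigr => x _ do rewrite mxE.
(* Entry [(i, j)] of the sum is the total outcome probability on [delta_mx j i], hence the trace of
   that matrix unit. *)
rewrite outcome_prob_sum // mxE /mxtrace.
transitivity (\sum_k ((k == j) && (k == i))%:R : R[i]).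
  by apply: eq_bigr => k _; rewrite mxE.
rewrite (bigD1 j) //= eqxx big1 => [|k /negPf -> //]; by rewrite addr0 eq_sym.
Qed.

End Protocols.

(** * The estimation protocol *)

Section Estimation.
Variable R : realType.

(** The suffix names the side on which identity factors are added, not the side on which [s]
    acts. *)
Definition pad_r m n (s : pauli_label m) : pauli_label (m + n) :=
  [ffun i => if split i is inl j then s j else (false, false)].

Definition pad_l m n (s : pauli_label n) : pauli_label (m + n) :=
  [ffun i => if split i is inr j then s j else (false, false)].

Lemma pauli_rec1 n (f : 'I_n -> bool * bool) :
  f =1 (fun=> (false, false)) -> pauli_rec R f = 1%:M.
Proof.
elim: n f => //= n IH f f0; rewrite f0 IH => [|i]; last exact: f0.
have -> : pauli1 R (false, false) = 1%:M.
  by apply/matrixP => -[[|[|//]] Hi] [[|[|//]] Hj]; rewrite !mxE.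
exact: (@tensq11 R 1 n).
Qed.

Lemma pauli_pad_r m n (s : pauli_label m) :
  pauli R (pad_r n s) = tensq (pauli R s) 1%:M.
Proof.
rewrite /pauli pauli_rec_cat (pauli_rec_ext R (g := s)) => [|i]; last first.
  by rewrite /= ffunE (unsplitK (inl i)).
rewrite [X in tensq _ X]pauli_rec1 // => i.
by rewrite /= ffunE (unsplitK (inr i)).
Qed.

Lemma pauli_pad_l m n (s : pauli_label n) :
  pauli R (pad_l m s) = tensq 1%:M (pauli R s).
Proof.
rewrite /pauli pauli_rec_cat [X in tensq X _]pauli_rec1 => [|i]; last first.
  by rewrite /= ffunE (unsplitK (inl i)).
rewrite (pauli_rec_ext R (g := s)) // => i.
by rewrite /= ffunE (unsplitK (inr i)).
Qed.

Lemma pauli_proj_pad_r m n (s : pauli_label m) b :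
  pauli_proj R (pad_r n s) b = tensq (pauli_proj R s b) 1%:M.
Proof. by rewrite /pauli_proj pauli_pad_r tensqZl tensqDl tensqZl tensq11. Qed.

Lemma pauli_proj_pad_l m n (s : pauli_label n) b :
  pauli_proj R (pad_l m s) b = tensq 1%:M (pauli_proj R s b).
Proof. by rewrite /pauli_proj pauli_pad_l tensqZr tensqDr tensqZr tensq11. Qed.

Lemma conj_by1 n (A : op R n) : conj_by 1%:M A = A.
Proof. by rewrite /conj_by mul1mx trmx1 map_mx1 mulmx1. Qed.

Lemma mxtrace_conj_by_ge0 n (V A : op R n) : psd A -> 0 <= \tr (conj_by V A).
Proof.
move=> A_psd; apply: sumr_ge0 => i _.
(* The [i]-th diagonal entry is the quadratic form of [A] at the adjoint of row [i] of [V]. No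
   unitarity is involved, so the bound covers measurement projections. *)
have := A_psd ((row i V)^t*); rewrite trmxCK; congr (0 <= _).
rewrite /conj_by -row_mul [LHS]mxE [RHS]mxE; apply: eq_bigr => j _.
by rewrite !mxE.
Qed.

(** [psd] is phrased through the quadratic form, so reality is read off from positivity: the
    expectation of a Pauli is the difference of its two nonnegative outcome weights. *)
Lemma mxtrace_pauli_real n (s : pauli_label n) (A : op R n) : psd A ->
  \tr (pauli R s *m A) \is Num.real.
Proof.
move=> A_psd.
have -> : \tr (pauli R s *m A) =
    \tr (conj_by (pauli_proj R s false) A) - \tr (conj_by (pauli_proj R s true) A).
  rewrite [X in _ = X - _]mxtrace_measure [X in _ = _ - X]mxtrace_measure.
  rewrite -mulrBr expr0 expr1 mul1r mulN1r opprD opprK addrACA.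
  by rewrite subrr add0r -mulr2n -[X in _ * X]mulr_natl mulrA mulVf ?mul1r // pnatr_eq0.
by apply: realB; apply: ger0_real; apply: mxtrace_conj_by_ge0.
Qed.

Lemma Re_sign (b : bool) (z : R[i]) :
  complex.Re ((-1) ^+ b * z) = (-1) ^+ b * complex.Re z.
Proof. by case: b; rewrite ?expr1 ?expr0 ?mul1r // !mulN1r raddfN. Qed.

Section Protocol.
Variables (n K : nat) (w : 'I_K -> R).
Hypothesis w_ge0 : forall i, 0 <= w i.
Hypothesis w_sum : \sum_i w i = 1.

(* A step measures the label drawn with weights [w], and flips the outcome
   according to the accompanying sign bit. *)
Notation step q := (('I_K -> bool) * ('I_K -> pauli_label q))%type.

Fixpoint estimation (X : Type) q (l : seq (step q)) (f : seq bool -> X) :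
    protocol R X q :=
  match l with
  | [::] => PReturn R q (f [::])
  | st :: l' => PRandom w_ge0 w_sum (fun i => PMeasure (st.2 i)
      (fun b => estimation l' (f \o cons (st.1 i (+) b))))
  end.

Lemma leaves_in_estimation (X : finType) (D : {set X}) q (l : seq (step q)) f :
  (forall bs, f bs \in D) -> leaves_in D (estimation l f).
Proof. by elim: l f => //= st l IH f fD i b; apply: IH => bs; apply: fD. Qed.

Definition pad_step m q (st : step q) : step (m + q) :=
  (st.1, fun i => pad_l m (st.2 i)).

(** The source of independence: steps that act on the right factor see the left one only through its
    trace, which is the probability of what was already observed there. *)
Lemma outcome_prob_pad (X : eqType) m q (l : seq (step q)) f (A : op R m)
    (B : op R q) (x : X) :
  outcome_prob (estimation (map (@pad_step m q) l) f) (tensq A B) x =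
  \tr A * outcome_prob (estimation l f) B x.
Proof.
elim: l f B => [|st l IH] f B /=; first by rewrite mxtrace_tensq mulrCA.
rewrite big_distrr; apply: eq_bigr => i _ /=; rewrite [RHS]mulrCA; congr (_ * _).
rewrite big_distrr; apply: eq_bigr => b _ /=.
by rewrite pauli_proj_pad_l conj_by_tensq conj_by1 IH.
Qed.

Variables (C : eqType) (sgn : C -> 'I_K -> bool) (lab : C -> 'I_K -> pauli_label n).

Fixpoint steps m (t : nat -> C) : seq (step (m * n)) :=
  match m with
  | 0 => [::]
  | m'.+1 => (sgn (t 0%N), fun i => pad_r (m' * n) (lab (t 0%N) i)) ::
             map (@pad_step n (m' * n)) (steps m' (t \o succn))
  end.

Definition sign_prob (A : op R n) (c : C) (b : bool) : R :=
  \sum_i w i * complex.Re (\tr (conj_by (pauli_proj R (lab c i) (sgn c i (+) b)) A)).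

Lemma outcome_prob_steps (X : eqType) m t (f : seq bool -> X) (A : op R n) x :
  psd A ->
  outcome_prob (estimation (steps m t) f) (tens_pow A m) x =
  (seqE (sign_prob A) m t (fun bs => (f bs == x)%:R))%:C%C.
Proof.
move=> A_psd; elim: m t f => [|m IH] t f /=.
  by rewrite mxtrace1 mulr1 rmorph_nat.
transitivity (\sum_i \sum_b (w i)%:C%C *
    (\tr (conj_by (pauli_proj R (lab (t 0%N) i) (sgn (t 0%N) i (+) b)) A) *
     (seqE (sign_prob A) m (t \o succn) (fun bs => (f (b :: bs) == x)%:R))%:C%C)).
  apply: eq_bigr => i _; rewrite -big_distrr; congr (_ * _) => /=.
  (* The tree sums over raw outcomes but records sign-corrected ones; the shift by the sign bit
     makes the recorded bit the summation variable. *)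
  rewrite (reindex_inj (@addbI (sgn (t 0%N) i))) /=; apply: eq_bigr => b _.
  rewrite (@pauli_proj_pad_r n (m * n)) (@conj_by_tensq R n (m * n)) conj_by1.
  by rewrite outcome_prob_pad IH addKb.
rewrite exchange_big rmorph_sum; apply: eq_bigr => b _ /=.
rewrite rmorphM rmorph_sum big_distrl; apply: eq_bigr => i _ /=.
rewrite rmorphM mulrA; do 2 congr (_ * _).
by apply/esym/RRe_real/ger0_real/mxtrace_conj_by_ge0.
Qed.

Lemma sign_prob_ge0 (A : op R n) c b : psd A -> 0 <= sign_prob A c b.
Proof.
move=> A_psd; apply: sumr_ge0 => i _; rewrite mulr_ge0 //.
have := mxtrace_conj_by_ge0 (pauli_proj R (lab c i) (sgn c i (+) b)) A_psd.
by rewrite lecE => /andP[].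
Qed.

Lemma sign_prob_sum (A : op R n) c : \tr A = 1 ->
  sign_prob A c false + sign_prob A c true = 1.
Proof.
move=> trA; rewrite -big_split -[RHS]w_sum; apply: eq_bigr => i _ /=.
rewrite -mulrDr -raddfD /= [X in complex.Re (X + _)]mxtrace_measure
  [X in complex.Re (_ + X)]mxtrace_measure -mulrDr.
rewrite addbT addbF signrN mulNr addrACA subrr addr0 trA -mulr2n mulVf ?pnatr_eq0 //.
by rewrite mulr1.
Qed.

Lemma bias_sign_prob (A : op R n) c :
  bias (sign_prob A) c =
  \sum_i w i * ((-1) ^+ sgn c i * complex.Re (\tr (pauli R (lab c i) *m A))).
Proof.
rewrite /bias -sumrB; apply: eq_bigr => i _ /=.
rewrite -mulrBr -raddfB /= [X in complex.Re (X - _)]mxtrace_measure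
  [X in complex.Re (_ - X)]mxtrace_measure -mulrBr.
rewrite addbT addbF signrN mulNr opprD opprK addrACA subrr add0r -mulr2n.
rewrite -[_ * _ *+ 2]mulr_natl mulrA mulVf ?pnatr_eq0 // mul1r; congr (_ * _).
exact: Re_sign.
Qed.

End Protocol.
End Estimation.

(** * Overlaps of the orbit states *)

Section Overlaps.
Variable R : realType.

Definition pauli_coef n (A : op R n) (s : pauli_label n) : R :=
  complex.Re (\tr (pauli R s *m A)).

Lemma pauli_coefE n (A : op R n) s : psd A ->
  (pauli_coef A s)%:C%C = \tr (pauli R s *m A).
Proof. by move=> A_psd; apply/RRe_real/mxtrace_pauli_real. Qed.

Lemma rtr_pauli n (A B : op R n) : psd A -> psd B ->
  \sum_s pauli_coef A s * pauli_coef B s = 2 ^+ n * rtr A B.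
Proof.
move=> A_psd B_psd; apply: complexI; rewrite rmorph_sum.
transitivity (\sum_(s : pauli_label n) \tr (pauli R s *m A) * \tr (pauli R s *m B)).
  by apply: eq_bigr => s _; rewrite rmorphM /= !pauli_coefE.
rewrite parseval.
(* Reality of [\tr (A *m B)] is itself a consequence of Parseval, each Pauli coefficient being
   real. *)
have trR : (complex.Re (\tr (A *m B)))%:C%C = \tr (A *m B).
  apply: RRe_real.
  have -> : \tr (A *m B) = (2 ^+ n)^-1 *
      \sum_(s : pauli_label n) \tr (pauli R s *m A) * \tr (pauli R s *m B).
    by rewrite parseval mulKf // expf_neq0 // pnatr_eq0.
  apply: realM; first by rewrite realV realX // realn.
  apply: rpred_sum => s _.
  by apply: realM; apply: mxtrace_pauli_real.
by rewrite rmorphM rmorphXn rmorph_nat /= /rtr trR.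
Qed.

(** Parseval against the matrix unit [delta_mx j i] recovers the entry [(i, j)] from the Pauli
    coefficients. *)
Lemma pauli_separates n (A B : op R n) :
  (forall s, \tr (pauli R s *m A) = \tr (pauli R s *m B)) -> A = B.
Proof.
move=> AB; apply/matrixP => i j.
have entry (C : op R n) : \tr (C *m delta_mx j i) = C i j.
  rewrite /mxtrace (bigD1 i) //= big1 ?addr0 => [|k /negPf ki].
    rewrite mxE (bigD1 j) //= big1 ?addr0 => [|k /negPf kj].
      by rewrite mxE !eqxx mulr1.
    by rewrite mxE kj mulr0.
  by rewrite mxE big1 // => l _; rewrite mxE ki andbF mulr0.
have d_neq0 : 2 ^+ n != 0 :> R[i] by rewrite expf_neq0 // pnatr_eq0.
apply: (mulfI d_neq0); rewrite -!entry -!parseval.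
by apply: eq_bigr => s _; rewrite AB.
Qed.

Lemma psd_conj_by n (V A : op R n) : psd A -> psd (conj_by V A).
Proof.
move=> A_psd v; have := A_psd (V^t* *m v); congr (0 <= _).
by rewrite /conj_by trmx_mul map_mxM /= trmxCK !mulmxA.
Qed.

Lemma mxtrace_conj_byC n (V A B : op R n) :
  \tr (conj_by V A *m B) = \tr (A *m conj_by (V^t*) B).
Proof. by rewrite /conj_by trmxCK -!mulmxA mxtrace_mulC !mulmxA. Qed.

Lemma rtr_conj_by n (V A B : op R n) : V \is unitarymx ->
  rtr (conj_by V A) (conj_by V B) = rtr A B.
Proof. by move=> Vu; rewrite /rtr conj_by_mul // mxtrace_conj_by. Qed.

Lemma sum_pauli_conj_by n (V A B : op R n) : psd A -> psd B ->
  \sum_s pauli_coef A s * complex.Re (\tr (conj_by V (pauli R s) *m B)) =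
  2 ^+ n * rtr (conj_by V A) B.
Proof.
move=> A_psd B_psd; have B'_psd := psd_conj_by (V^t*) B_psd.
have -> : rtr (conj_by V A) B = rtr A (conj_by (V^t*) B).
  by rewrite /rtr mxtrace_conj_byC.
rewrite -rtr_pauli //.
by apply: eq_bigr => s _; rewrite mxtrace_conj_byC.
Qed.

(** In Pauli coordinates this sums [2ab <= a^2 + b^2]; equality would force all coefficients to
    agree, hence [A = B]. For two states of one orbit the right side is twice the purity, whence
    [Delta > 0]. *)
Lemma rtr_lt_mean n (A B : op R n) : psd A -> psd B -> A != B ->
  rtr A B *+ 2 < rtr A A + rtr B B.
Proof.
move=> A_psd B_psd neq.
have d_gt0 : 0 < 2 ^+ n :> R by rewrite exprn_gt0.
rewrite -(ltr_pM2l d_gt0) mulrnAr mulrDr -!rtr_pauli // -sumrMnl -big_split /=.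
have le s : pauli_coef A s * pauli_coef B s *+ 2 <=
    pauli_coef A s * pauli_coef A s + pauli_coef B s * pauli_coef B s.
  by rewrite -subr_ge0; have := sqr_ge0 (pauli_coef A s - pauli_coef B s); lra.
rewrite lt_neqAle ler_sum // andbT; apply: contra neq => /eqP eq.
apply/eqP/pauli_separates => s; rewrite -!pauli_coefE //; congr (_%:C)%C.
have /eqP := eq; rewrite eq_sym -subr_eq0 -sumrB psumr_eq0 => [|t _]; last first.
  by rewrite subr_ge0.
move=> /allP/(_ s); rewrite mem_index_enum => /(_ isT) /eqP.
move=> /eqP h; apply/eqP; rewrite -subr_eq0 -sqrf_eq0 -(eqP h).
by apply/eqP; ring.
Qed.

Lemma pauli_coef0 n (A : op R n) :
  pauli_coef A [ffun=> (false, false)] = complex.Re (\tr A).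
Proof. by rewrite /pauli_coef /pauli pauli_rec1 ?mul1mx // => i; rewrite ffunE. Qed.

(** The identity coefficient alone contributes 1. Positivity is what handles the seed 0 of the
    maximum in [Delta]. *)
Lemma rtr_state_gt0 n (rho : op R n) : state rho -> 0 < rtr rho rho.
Proof.
move=> [rho_psd tr1]; have d_gt0 : 0 < 2 ^+ n :> R by rewrite exprn_gt0.
rewrite -(pmulr_rgt0 _ d_gt0) -rtr_pauli // (bigD1 [ffun=> (false, false)]) //=.
rewrite pauli_coef0 tr1 /= mulr1 ltr_wpDr // sumr_ge0 // => s _.
by rewrite -expr2 sqr_ge0.
Qed.

Lemma normc_real (x : R) : ComplexField.Normc.normc x%:C%C = `|x|.
Proof. by rewrite /= expr0n addr0 sqrtr_sqr. Qed.

Lemma Lnorm1E n (rho : op R n) : psd rho ->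
  Lnorm1 rho = \sum_s `|pauli_coef rho s|.
Proof.
by move=> rho_psd; apply: eq_bigr => s _; rewrite -pauli_coefE // normc_real.
Qed.

Lemma Lnorm1_gt0 n (rho : op R n) : state rho -> 0 < Lnorm1 rho.
Proof.
move=> [rho_psd tr1]; rewrite Lnorm1E // (bigD1 [ffun=> (false, false)]) //=.
by rewrite pauli_coef0 tr1 /= normr1 ltr_wpDr // sumr_ge0.
Qed.

(** [pauli_group] allows any power of [i] as phase, but the conjugate of a Pauli still squares to
    the identity, which leaves only the phases 1 and -1. *)
Lemma clifford_pauli n (V : op R n) (s : pauli_label n) : clifford V ->
  exists p : pauli_label n * bool, conj_by V (pauli R s) = (-1) ^+ p.2 *: pauli R p.1.
Proof.
move=> [Vu Vp].
have [|k [s' Es]] := Vp (pauli R s); first by exists 0, s; rewrite expr0 scale1r.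
have sqr1 : (('i%C ^+ k) ^+ 2 : R[i]) = 1.
  have : conj_by V (pauli R s) *m conj_by V (pauli R s) = 1%:M.
    by rewrite conj_by_mul // pauli_sqr /conj_by mulmx1 (unitarymxP Vu).
  rewrite Es -scalemxAl -scalemxAr pauli_sqr scalerA -expr2 => /matrixP.
  have d_gt0 : (0 < 2 ^ n)%N by rewrite expn_gt0.
  by move=> /(_ (Ordinal d_gt0) (Ordinal d_gt0)); rewrite !mxE eqxx mulr1.
move/eqP: sqr1; rewrite sqrf_eq1 Es => /orP[] /eqP ->.
  by exists (s', false).
by exists (s', true).
Qed.

Definition clifford_act n (V : op R n) (s : pauli_label n) : pauli_label n * bool :=
  odflt (s, false) [pick p : pauli_label n * bool |
    conj_by V (pauli R s) == (-1) ^+ p.2 *: pauli R p.1].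

Lemma clifford_actE n (V : op R n) (s : pauli_label n) : clifford V ->
  conj_by V (pauli R s) =
  (-1) ^+ (clifford_act V s).2 *: pauli R (clifford_act V s).1.
Proof.
move=> /(clifford_pauli s) [p Ep]; rewrite /clifford_act.
by case: pickP => [q /eqP // | /(_ p)]; rewrite Ep eqxx.
Qed.

Lemma mxtrace_tens_pow n (A : op R n) m : \tr A = 1 -> \tr (tens_pow A m) = 1.
Proof.
move=> trA; elim: m => [|m IH]; first by rewrite mxtrace1.
by apply: etrans (@mxtrace_tensq R n (m * n) _ _) _; rewrite trA IH mulr1.
Qed.

End Overlaps.

(** * The orbit of a state under a projective representation *)

Section ProjectiveAction.
Variables (R : realType) (gT : finGroupType) (G : {group gT}) (n : nat).
Variable U : gT -> op R n.
Hypothesis reprU : proj_repr G U.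

Lemma conj_by_repr g h A : g \in G -> h \in G ->
  conj_by (U g) (conj_by (U h) A) = conj_by (U (g * h)%g) A.
Proof.
move=> gG hG; rewrite conj_by_comp; case: reprU => _ /(_ g h gG hG)[c c1 ->].
rewrite /conj_by linearZ /= map_mxZ -!scalemxAl -scalemxAr scalerA.
by rewrite -normCK c1 expr1n scale1r.
Qed.

(** A projective representation may send 1 to a phase times the identity. Conjugation by [U 1] is
    nevertheless idempotent and invertible, hence trivial. *)
Lemma conj_by_repr1 A : conj_by (U 1%g) A = A.
Proof.
have U1 : U 1%g \is unitarymx by case: reprU => + _; apply.
have conjK B : conj_by ((U 1%g)^t*) (conj_by (U 1%g) B) = B.
  by rewrite conj_by_comp unitarymx_adjl // conj_by1.
have := congr1 (conj_by ((U 1%g)^t*)) (conj_by_repr A (group1 G) (group1 G)).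
by rewrite mulg1 !conjK.
Qed.

(** Cosets are the fibres of the orbit map. [stabg] is a bare set here, and this description takes
    the place of its subgroup structure. *)
Lemma lcoset_stabgE rho g : g \in G ->
  (g *: stabg G U rho)%g =
  [set h in G | conj_by (U h) rho == conj_by (U g) rho].
Proof.
move=> gG; apply/setP => h; rewrite mem_lcoset [LHS]inE [RHS]inE.
rewrite (groupMl h (groupVr gG)).
case: (boolP (h \in G)) => [hG|_]; last by rewrite !andFb.
rewrite !andTb; apply/eqP/eqP => E.
  have := conj_by_repr rho gG (groupM (groupVr gG) hG).
  by rewrite E mulKVg.
rewrite -(conj_by_repr rho (groupVr gG) hG) E (conj_by_repr rho (groupVr gG) gG).
by rewrite mulVg conj_by_repr1.
Qed.

Lemma Delta_gt0 rho : state rho -> 0 < Delta G U rho.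
Proof.
move=> rho_state; have [rho_psd _] := rho_state.
rewrite subr_gt0; apply: bigmax_lt => [|g]; first exact: rtr_state_gt0.
rewrite !inE negb_and => /andP[ngS gG]; rewrite gG /= in ngS.
have Ug : U g \is unitarymx by case: reprU => + _; apply.
rewrite eq_sym in ngS.
have := rtr_lt_mean rho_psd (psd_conj_by (U g) rho_psd) ngS.
by rewrite rtr_conj_by // -mulr2n ltr_pMn2r.
Qed.

(** Unitary invariance moves the pair [(g, h)] to [(1, g^-1 * h)], so the maximum over overlaps with
    [rho] itself controls all pairs of orbit states. *)
Lemma rtr_le_Delta rho g h : g \in G -> h \in G ->
  conj_by (U g) rho != conj_by (U h) rho ->
  rtr (conj_by (U g) rho) (conj_by (U h) rho) <= rtr rho rho - Delta G U rho.
Proof.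
move=> gG hG neq; rewrite /Delta subKr.
have -> : conj_by (U h) rho = conj_by (U g) (conj_by (U (g^-1 * h)%g) rho).
  by rewrite conj_by_repr ?groupM ?groupV // mulKVg.
rewrite rtr_conj_by; last by case: reprU => + _; apply.
apply: (@le_bigmax_cond _ _ _ _ (g^-1 * h)%g _ (fun x => rtr rho (conj_by (U x) rho))).
rewrite !inE groupM ?groupV // andbT /=; apply: contra neq => /eqP E.
by rewrite -{1}E conj_by_repr ?groupM ?groupV // mulKVg.
Qed.

End ProjectiveAction.

(** The round-robin schedule gives every coset exactly [k] rounds, as the tail bounds require. *)
Lemma sum_eq_cycle (R : pzSemiRingType) (T : eqType) (x0 : T) (s : seq T) c k :
  uniq s -> c \in s ->
  \sum_(i < k * size s) (nth x0 s (i %% size s)%N == c)%:R = k%:R :> R.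
Proof.
move=> s_uniq cs; elim: k => [|k IH]; first by rewrite big_ord0.
rewrite mulSn big_split_ord /= [RHS]mulrS; congr (_ + _); last first.
  by rewrite -IH; apply: eq_bigr => i _; rewrite modnDl.
transitivity (\sum_(x <- s) (x == c)%:R : R).
  rewrite (big_nth x0) big_mkord; apply: eq_bigr => i _.
  by rewrite modn_small.
rewrite (bigD1_seq c) //= eqxx big1 ?addr0 // => x /negPf -> //.
Qed.

(** * Identification of the coset by sampling Paulis *)

Section CosetEstimation.
Variables (R : realType) (gT : finGroupType) (G : {group gT}) (n : nat).
Variable U : gT -> op R n.
Hypothesis reprU : proj_repr G U.
Hypothesis cliffU : forall g, g \in G -> clifford (U g).
Variable rho : op R n.
Hypothesis rho_state : state rho.

Notation label i := (enum_val (i : 'I_#|{: pauli_label n}|)).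

Definition pauli_weight (i : 'I_#|{: pauli_label n}|) : R :=
  `|pauli_coef rho (label i)| / Lnorm1 rho.

(** A Clifford sends a Pauli to a signed Pauli, of which only the unsigned part is a measurement
    label; its sign is merged here with that of the coefficient. *)
Definition coset_sign (c : {set gT}) (i : 'I_#|{: pauli_label n}|) : bool :=
  (pauli_coef rho (label i) < 0) (+) (clifford_act (U (repr c)) (label i)).2.

Definition coset_label (c : {set gT}) (i : 'I_#|{: pauli_label n}|) :
  pauli_label n := (clifford_act (U (repr c)) (label i)).1.

Lemma pauli_weight_ge0 i : 0 <= pauli_weight i.
Proof. by rewrite divr_ge0 // ltW // Lnorm1_gt0. Qed.

Lemma pauli_weight_sum : \sum_i pauli_weight i = 1.
Proof.
rewrite -big_distrl /= -(big_enum_val (fun s => `|pauli_coef rho s|)) /=.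
by rewrite -Lnorm1E ?divff ?gt_eqF ?Lnorm1_gt0 //; case: rho_state.
Qed.

Notation prob A := (sign_prob pauli_weight coset_sign coset_label A).

Lemma bias_coset c A : repr c \in G -> psd A ->
  bias (prob A) c = 2 ^+ n / Lnorm1 rho * rtr (conj_by (U (repr c)) rho) A.
Proof.
move=> cG A_psd; have [rho_psd _] := rho_state.
rewrite bias_sign_prob mulrAC -sum_pauli_conj_by // big_distrl /=.
rewrite (big_enum_val (fun s => pauli_coef rho s *
  complex.Re (\tr (conj_by (U (repr c)) (pauli R s) *m A)) / Lnorm1 rho)) /=.
apply: eq_bigr => i _; rewrite clifford_actE; last exact: cliffU.
rewrite -scalemxAl mxtraceZ /pauli_weight /coset_sign signr_addb.
(* The sign correction undoes the modulus in the sampling weight, so the average is linear in the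
   coefficients and Parseval applies. *)
rewrite -[X in _ = X * _ / _]mulr_sign_norm.
rewrite Re_sign; move: (complex.Re _) (clifford_act _ _).2 => z b.
by move: (pauli_coef _ _) => p; ring.
Qed.

Notation S := (stabg G U rho).
Notation D := (lcosets S G).

Lemma repr_lcoset_stabg g : g \in G ->
  repr (g *: S)%g \in G /\ conj_by (U (repr (g *: S)%g)) rho = conj_by (U g) rho.
Proof.
move=> gG.
have in_coset x : x \in (g *: S)%g -> x \in G /\ conj_by (U x) rho = conj_by (U g) rho.
  rewrite (lcoset_stabgE reprU rho gG) inE => /andP[xG /eqP xg].
  by split; [exact: xG | exact: xg].
apply: in_coset; apply: (@mem_repr _ _ g).
by rewrite (lcoset_stabgE reprU rho gG) inE gG eqxx.
Qed.

Lemma coset_povm k : S != G -> exists M : {set gT} -> op R (k * #|D| * n),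
  stabilizer_povm D M /\
  forall g, g \in G ->
    1 - #|D|%:R * expR (- (alpha G U rho * k%:R)) <=
    rtr (M (g *: S)%g) (tens_pow (conj_by (U g) rho) (k * #|D|)).
Proof.
move=> neSG; have [rho_psd rho_tr] := rho_state.
(* The right coset has bias [(d / L) * tr (rho^2)] and the others at most
   [(d / L) * (tr (rho^2) - Delta)]: [theta] is the midpoint, [delta] half the gap, and
   [delta ^+ 2 / 2] is [alpha]. *)
pose delta : R := 2 ^+ n / Lnorm1 rho * (Delta G U rho / 2).
pose theta : R := 2 ^+ n / Lnorm1 rho * (rtr rho rho - Delta G U rho / 2).
pose t (j : nat) := nth S (enum D) (j %% #|D|)%N.
pose f bs := threshold_decode D S t (k%:R * theta) bs.
have SD : S \in D.
  by apply/lcosetsP; exists 1%g; rewrite ?group1 // lcoset1.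
have d_ge0 : 0 <= 2 ^+ n / Lnorm1 rho.
  by rewrite divr_ge0 ?exprn_ge0 // ltW // Lnorm1_gt0.
pose T := estimation pauli_weight_ge0 pauli_weight_sum
  (steps coset_sign coset_label (k * #|D|) t) f.
exists (effect T); split.
  by apply/stabilizer_povm_effect/leaves_in_estimation => bs;
    apply: threshold_decode_in.
move=> g gG; set A := conj_by (U g) rho.
have A_psd : psd A by apply: psd_conj_by.
have Ug : U g \is unitarymx by case: reprU => + _; apply.
have trA : \tr A = 1 by rewrite mxtrace_conj_by.
rewrite /rtr mxtrace_effect outcome_prob_steps //=.
have -> : alpha G U rho = delta ^+ 2 / 2.
  rewrite /alpha /delta natrX; have := Lnorm1_gt0 rho_state => /gt_eqF L0.
  by field; rewrite L0.
have gD : (g *: S)%g \in D by apply/lcosetsP; exists g.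
apply: threshold_decodeP => //.
- by move=> c b; apply: sign_prob_ge0 => //; apply: pauli_weight_ge0.
- by move=> c; apply: sign_prob_sum => //; apply: pauli_weight_sum.
- by rewrite mulr_ge0 // divr_ge0 // ltW // Delta_gt0.
- move=> c cD; rewrite /t cardE; apply: sum_eq_cycle; first exact: enum_uniq.
  by rewrite mem_enum.
- have [rG E] := repr_lcoset_stabg gG.
  rewrite bias_coset // E rtr_conj_by // /theta /delta -mulrDr.
  by rewrite subrK.
- move=> _ /lcosetsP[h hG ->] ne; have [rG E] := repr_lcoset_stabg hG.
  rewrite bias_coset // E /theta /delta -mulrBr ler_wpM2l //.
  rewrite -addrA -opprD -splitr; apply: rtr_le_Delta => //.
  apply: contra ne => /eqP hg; apply/eqP.
  by rewrite (lcoset_stabgE reprU rho hG) (lcoset_stabgE reprU rho gG) hg.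
Qed.

End CosetEstimation.

Theorem lemma6 (R : realType) (gT : finGroupType) (G : {group gT}) (n : nat)
    (U : gT -> op R n)
    (reprU : proj_repr G U)
    (cliffU : forall g, g \in G -> clifford (U g))
    (rho : op R n) (rho_state : state rho)
    (a : R)
    (a_def : stabg G U rho <> G -> a = alpha G U rho)
    (a_triv : stabg G U rho = G -> 0 < a) :
  let S := stabg G U rho in
  let N := #|lcosets S G| in
  0 < a /\
  exists M : forall k : nat, {set gT} -> op R (k * N * n),
    (forall k : nat, stabilizer_povm (lcosets S G) (M k)) /\
    (forall k : nat,
       let p g := rtr (M k (g *: S)%g) (tens_pow (conj_by (U g) rho) (k * N)) in
       1 - N%:R * expR (- (a * k%:R)) <= \big[Order.min/p 1%g]_(g in G) p g).
Proof.
move=> S N.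
have [SG|/eqP neSG] := eqVneq S (G : {set gT}).
  split; first exact: a_triv.
  (* With a single coset the protocol that always answers [S] is never wrong. *)
  exists (fun k => effect (PReturn R (k * N * n) S)); split=> k.
    apply: stabilizer_povm_effect; apply/lcosetsP; exists 1%g; first exact: group1.
    by rewrite lcoset1.
  have p1 g : g \in G -> rtr (effect (PReturn R (k * N * n) S) (g *: S)%g)
      (tens_pow (conj_by (U g) rho) (k * N)) = 1.
    move=> gG; rewrite /rtr mxtrace_effect /= SG lcoset_id // eqxx mul1r.
    rewrite mxtrace_tens_pow // mxtrace_conj_by; first by case: rho_state.
    by case: reprU => + _; apply.
  apply: le_bigmin => [|g gG]; rewrite p1 ?group1 //;
    by rewrite gerBl mulr_ge0 // expR_ge0.
have aE := a_def neSG; split.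
  have Delta_pos : 0 < Delta G U rho by exact: Delta_gt0.
  rewrite aE /alpha divr_gt0 // mulr_gt0 // ?exprn_gt0 ?Lnorm1_gt0 //.
  by rewrite ltr0n expn_gt0.
have /eqP neSG' := neSG.
have Mk k := coset_povm reprU cliffU rho_state k neSG'.
pose M k : {set gT} -> op R (k * N * n) := sval (cid (Mk k)).
exists M; split=> k.
  by case: (svalP (cid (Mk k))).
have [_ Mp] := svalP (cid (Mk k)); rewrite /= aE.
(* The seed of the minimum is the value at [1%g], a member of [G], so it obeys the same bound. *)
apply: le_bigmin => [|g gG]; last exact: Mp.
exact: Mp (group1 G).
Qed.
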